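(* (Completeness of D.LL.) For all formulas $A,B$ of the language $\mathcal{L}$ of lattice logic, if $A\vdash B$ is a theorem of the Hilbert-style presentation of lattice logic, then the multi-type sequent $A^\tau\vdash B_\tau$ is derivable in D.LL.
   Context: **Lattice logic.** The language $\mathcal{L}$ over a set $\mathsf{AtProp}$ of atomic propositions: $A::=p\mid\top\mid\bot\mid A\wedge A\mid A\vee A$. The Hilbert-style presentation has axioms $A\vdash A$, $\bot\vdash A$, $A\vdash\top$, $A\vdash A\vee B$, $B\vdash A\vee B$, $A\wedge B\vdash A$, $A\wedge B\vdash B$, and rules: from $A\vdash B$ and $B\vdash C$ infer $A\vdash C$; from $A\vdash B$ infer $A[C/p]\vdash B[C/p]$; from $A\vdash B$ and $A\vdash C$ infer $A\vdash B\wedge C$; from $A\vdash C$ and $B\vdash C$ infer $A\vee B\vdash C$. **Language of D.LL** over $\mathsf{AtProp}$. There are three types $\mathsf{L}$ (Lattice), $\mathsf{P}$ (Left), $\mathsf{P}^{\mathrm{op}}$ (Right), each with formulas and structures. - Type $\mathsf{L}$: formulas $A::=p\mid\top\mid\bot\mid ◆\alpha\mid\blacksquare\xi$; structures $X::=A\mid \mathrm{I}\mid\bullet\Gamma\mid\bullet\Pi$. - Type $\mathsf{P}$: formulas $\alpha::=\Box A\mid\alpha\cap\alpha\mid\alpha\cup\alpha$; structures $\Gamma::=\alpha\mid\circ X\mid\circledS\mid\Gamma\cdot\Gamma\mid\Gamma\supset\Gamma$. - Type $\mathsf{P}^{\mathrm{op}}$: formulas $\xi::=\Diamond A\mid\xi\cap\xi\mid\xi\cup\xi$;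 structures $\Pi::=\xi\mid\circ X\mid\circledS\mid\Pi\cdot\Pi\mid\Pi\supset\Pi$. (The connectives of type $\mathsf{P}^{\mathrm{op}}$ carry a superscript $^{\mathrm{op}}$ which is suppressed.) A sequent $x\vdash y$ has $x,y$ structures of the same type. In $x\vdash y$, $x$ is in precedent position and $y$ in succedent position; substructures inherit the position of the parent, except that the first argument of $\supset$ has the opposite position. Only sequents are considered in which $\circ X$ of type $\mathsf{P}$ and $\bullet\Pi$ occur only in succedent position, and $\circ X$ of type $\mathsf{P}^{\mathrm{op}}$ and $\bullet\Gamma$ occur only in precedent position. **Rules of D.LL.** Notation: ''premises / conclusion''; ''//'' denotes a double-line rule, usable in both directions. $X,Y$ are $\mathsf{L}$-structures, $\Gamma$ a $\mathsf{P}$-structure, $\Pi$ a $\mathsf{P}^{\mathrm{op}}$-structure; $A$, $\alpha$, $\xi$ are formulas of type $\mathsf{L}$, $\mathsf{P}$, $\mathsf{P}^{\mathrm{op}}$ respectively. In the pure $\mathsf{P}$/$\mathsf{P}^{\mathrm{op}}$ rules $S,T,U,V$ are structures and $s,t$ formulas, all of the same type, which is either $\mathsf{P}$ or $\mathsf{P}^{\mathrm{op}}$. - Multi-type display rules: $\Gamma\vdash\circ X$ // $\bullet\Gamma\vdash X$; $\ \circ X\vdash\Pi$ // $X\vdash\bullet\Pi$. - Pure $\mathsf{P}$/$\mathsf{P}^{\mathrm{op}}$ display rules: $S\cdot T\vdash U$ // $T\vdash S\supset U$; $\ S\vdash T\cdot U$ // $T\supset S\vdash U$. - Pure $\mathsf{P}$/$\mathsf{P}^{\mathrm{op}}$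 structural rules. Cut: $S\vdash s$, $s\vdash T$ / $S\vdash T$. Unit: $S\vdash T$ // $S\cdot\circledS\vdash T$; $S\vdash T$ // $S\vdash T\cdot\circledS$. Exchange: $S\cdot T\vdash U$ / $T\cdot S\vdash U$; $S\vdash T\cdot U$ / $S\vdash U\cdot T$. Associativity: $(S\cdot T)\cdot U\vdash V$ // $S\cdot(T\cdot U)\vdash V$; $S\vdash(T\cdot U)\cdot V$ // $S\vdash T\cdot(U\cdot V)$. Weakening: $S\vdash T$ / $S\cdot U\vdash T$; $S\vdash T$ / $S\vdash T\cdot U$. Contraction: $S\cdot S\vdash T$ / $S\vdash T$; $S\vdash T\cdot T$ / $S\vdash T$. - Pure $\mathsf{P}$/$\mathsf{P}^{\mathrm{op}}$ operational rules: $s\cdot t\vdash S$ / $s\cap t\vdash S$; $\ S\vdash s$, $T\vdash t$ / $S\cdot T\vdash s\cap t$; $\ s\vdash S$, $t\vdash T$ / $s\cup t\vdash S\cdot T$; $\ S\vdash s\cdot t$ / $S\vdash s\cup t$. - Pure $\mathsf{L}$ rules. Id: $p\vdash p$ (axiom, $p$ atomic). Cut: $X\vdash A$, $A\vdash Y$ / $X\vdash Y$. $\mathrm{I}$-weakening: $\mathrm{I}\vdash X$ / $Y\vdash X$. Constants: $\mathrm{I}\vdash X$ / $\top\vdash X$; $\mathrm{I}\vdash\top$ (axiom); $\bot\vdash\mathrm{I}$ (axiom); $X\vdash\mathrm{I}$ / $X\vdash\bot$. - Operational rules for multi-type connectives: $\circ A\vdash\Pi$ / $\Diamond A\vdash\Pi$;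 $\ X\vdash A$ / $\circ X\vdash\Diamond A$ (type $\mathsf{P}^{\mathrm{op}}$); $\ X\vdash\bullet\xi$ / $X\vdash\blacksquare\xi$; $\ \xi\vdash\Pi$ / $\blacksquare\xi\vdash\bullet\Pi$; $\ \bullet\alpha\vdash X$ / $◆\alpha\vdash X$; $\ \Gamma\vdash\alpha$ / $\bullet\Gamma\vdash ◆\alpha$; $\ \Gamma\vdash\circ A$ / $\Gamma\vdash\Box A$; $\ A\vdash X$ / $\Box A\vdash\circ X$ (type $\mathsf{P}$). **Translations** from $\mathcal{L}$-formulas to $\mathsf{L}$-type formulas of D.LL: $\top^\tau=◆\Box\top$, $\bot^\tau=◆\Box\bot$, $p^\tau=◆\Box p$, $(A\wedge B)^\tau=◆(\Box A^\tau\cap\Box B^\tau)$, $(A\vee B)^\tau=◆(\Box A^\tau\cup\Box B^\tau)$; and $\top_\tau=\blacksquare\Diamond\top$, $\bot_\tau=\blacksquare\Diamond\bot$, $p_\tau=\blacksquare\Diamond p$, $(A\wedge B)_\tau=\blacksquare(\Diamond A_\tau\cap\Diamond B_\tau)$, $(A\vee B)_\tau=\blacksquare(\Diamond A_\tau\cup\Diamond B_\tau)$ (with $\cap,\cup$ of type $\mathsf{P}^{\mathrm{op}}$ in the second group).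
   Formalization: D.LL is taken with the additional mirror rule ''from X ⊢ I infer X ⊢ Y''; with the listed rules alone ⊥^τ ⊢ p_τ is not derivable although ⊥ ⊢ p is an axiom, so the claim would fail. Equality of atomic propositions is decidable, to define A[C/p]. *)

(* Defs.v *)
From Stdlib Require List.
From mathcomp Require Import all_boot.
Set Implicit Arguments.
Unset Strict Implicit.
Unset Printing Implicit Defensive.

Inductive lat (V : Type) : Type :=
| LatAtom (p : V)
| LatTop
| LatBot
| LatAnd (A B : lat V)
| LatOr (A B : lat V).
Arguments LatTop {V}.
Arguments LatBot {V}.

(* A[C/p] *)
Fixpoint lat_subst (V : eqType) (p : V) (C A : lat V) : lat V :=
  match A with
  | LatAtom q => if q == p then C else LatAtom q
  | LatTop => LatTop
  | LatBot => LatBot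
  | LatAnd A1 A2 => LatAnd (lat_subst p C A1) (lat_subst p C A2)
  | LatOr A1 A2 => LatOr (lat_subst p C A1) (lat_subst p C A2)
  end.

Inductive hilbert (V : eqType) : lat V -> lat V -> Prop :=
| HilbId A : hilbert A A
| HilbBot A : hilbert LatBot A
| HilbTop A : hilbert A LatTop
| HilbOr1 A B : hilbert A (LatOr A B)
| HilbOr2 A B : hilbert B (LatOr A B)
| HilbAnd1 A B : hilbert (LatAnd A B) A
| HilbAnd2 A B : hilbert (LatAnd A B) B
| HilbTrans A B C : hilbert A B -> hilbert B C -> hilbert A C
| HilbSubst p C A B :
    hilbert A B -> hilbert (lat_subst p C A) (lat_subst p C B)
| HilbAndI A B C : hilbert A B -> hilbert A C -> hilbert A (LatAnd B C)
| HilbOrE A B C : hilbert A C -> hilbert B C -> hilbert (LatOr A B) C.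

(* The non-lattice types: Left is P and Right is P^op.  The connectives shared
   by the two types are indexed by [side]. *)
Inductive side := Left | Right.

Inductive lform (V : Type) : Type :=
| Atom (p : V)
| Top
| Bot
| BlackDia (a : hform V Left)
| BlackBox (x : hform V Right)
with hform (V : Type) : side -> Type :=
| WhiteBox (A : lform V) : hform V Left
| WhiteDia (A : lform V) : hform V Right
| Cap d (s t : hform V d) : hform V d
| Cup d (s t : hform V d) : hform V d.
Arguments Top {V}.
Arguments Bot {V}.

(* [Bullet] and [Circ] cover the structural connectives of both types, e.g.
   [Bullet (d := Left) G] and [Bullet (d := Right) P]. *)
Inductive lstr (V : Type) : Type :=
| LF (A : lform V)
| StrI
| Bullet d (G : hstr V d)
with hstr (V : Type) : side -> Type :=
| HF d (s : hform V d) : hstr V d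
| Circ d (X : lstr V) : hstr V d
| StrS d : hstr V d
| Dot d (S T : hstr V d) : hstr V d
| Imp d (S T : hstr V d) : hstr V d.
Arguments StrI {V}.
Arguments Circ {V} d X.
Arguments StrS {V d}.

Inductive sequent (V : Type) : Type :=
| LSeq (X Y : lstr V)
| HSeq d (S T : hstr V d).

Declare Scope dll_scope.
Delimit Scope dll_scope with dll.
Notation "X ⊢L Y" := (LSeq X Y) (at level 75, no associativity) : dll_scope.
Notation "S ⊢H T" := (HSeq S T) (at level 75, no associativity) : dll_scope.
Notation "S · T" := (Dot S T) (at level 40, left associativity) : dll_scope.
Notation "S ⊃ T" := (Imp S T) (at level 55, right associativity) : dll_scope.
Local Open Scope dll_scope.

Inductive position := Precedent | Succedent.

Definition flip (q : position) : position :=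
  match q with Precedent => Succedent | Succedent => Precedent end.

(* [Bullet] over P and [Circ] of type P^op are left adjoints, hence restricted
   to precedent position; the other two are right adjoints. *)
Definition bullet_ok (d : side) (q : position) : bool :=
  match d, q with
  | Left, Precedent | Right, Succedent => true
  | _, _ => false
  end.

Definition circ_ok (d : side) (q : position) : bool :=
  match d, q with
  | Left, Succedent | Right, Precedent => true
  | _, _ => false
  end.

Fixpoint lstr_ok (V : Type) (q : position) (X : lstr V) {struct X} : bool :=
  match X with
  | LF _ | StrI => true
  | Bullet d G => bullet_ok d q && hstr_ok q G
  end
with hstr_ok (V : Type) (q : position) (d : side) (T : hstr V d) {struct T}
    : bool :=
  match T with
  | HF _ _ | StrS _ => true
  | Circ d X => circ_ok d q && lstr_ok q X
  | Dot _ T1 T2 => hstr_ok q T1 && hstr_ok q T2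
  | Imp _ T1 T2 => hstr_ok (flip q) T1 && hstr_ok q T2
  end.

Definition seq_ok (V : Type) (c : sequent V) : bool :=
  match c with
  | X ⊢L Y => lstr_ok Precedent X && lstr_ok Succedent Y
  | T ⊢H U => hstr_ok Precedent T && hstr_ok Succedent U
  end.

(* The double-line rules: [drule c1 c2] is "c1 // c2". *)
Inductive drule (V : Type) : sequent V -> sequent V -> Prop :=
| DispBullet (G : hstr V Left) X : drule (G ⊢H Circ Left X) (Bullet G ⊢L X)
| DispCirc (P : hstr V Right) X : drule (Circ Right X ⊢H P) (X ⊢L Bullet P)
| DispPrec d (S T U : hstr V d) : drule (S · T ⊢H U) (T ⊢H S ⊃ U)
| DispSucc d (S T U : hstr V d) : drule (S ⊢H T · U) (T ⊃ S ⊢H U)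
| UnitPrec d (S T : hstr V d) : drule (S ⊢H T) (S · StrS ⊢H T)
| UnitSucc d (S T : hstr V d) : drule (S ⊢H T) (S ⊢H T · StrS)
| AssocPrec d (S T U W : hstr V d) :
    drule ((S · T) · U ⊢H W) (S · (T · U) ⊢H W)
| AssocSucc d (S T U W : hstr V d) :
    drule (S ⊢H (T · U) · W) (S ⊢H T · (U · W)).

(* [rule ps c]: the premises [ps] yield the conclusion [c] in one step. *)
Inductive rule (V : Type) : seq (sequent V) -> sequent V -> Prop :=
| RDown c1 c2 : drule c1 c2 -> rule [:: c1] c2
| RUp c1 c2 : drule c1 c2 -> rule [:: c2] c1
| HCut d (S T : hstr V d) s : rule [:: S ⊢H HF s; HF s ⊢H T] (S ⊢H T)
| ExchPrec d (S T U : hstr V d) : rule [:: S · T ⊢H U] (T · S ⊢H U)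
| ExchSucc d (S T U : hstr V d) : rule [:: S ⊢H T · U] (S ⊢H U · T)
| WeakPrec d (S T U : hstr V d) : rule [:: S ⊢H T] (S · U ⊢H T)
| WeakSucc d (S T U : hstr V d) : rule [:: S ⊢H T] (S ⊢H T · U)
| ContrPrec d (S T : hstr V d) : rule [:: S · S ⊢H T] (S ⊢H T)
| ContrSucc d (S T : hstr V d) : rule [:: S ⊢H T · T] (S ⊢H T)
| CapL d (s t : hform V d) S : rule [:: HF s · HF t ⊢H S] (HF (Cap s t) ⊢H S)
| CapR d (s t : hform V d) S T :
    rule [:: S ⊢H HF s; T ⊢H HF t] (S · T ⊢H HF (Cap s t))
| CupL d (s t : hform V d) S T :
    rule [:: HF s ⊢H S; HF t ⊢H T] (HF (Cup s t) ⊢H S · T)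
| CupR d (s t : hform V d) S : rule [:: S ⊢H HF s · HF t] (S ⊢H HF (Cup s t))
| LId p : rule [::] (LF (Atom p) ⊢L LF (Atom p))
| LCut X Y A : rule [:: X ⊢L LF A; LF A ⊢L Y] (X ⊢L Y)
| IWeakPrec X Y : rule [:: StrI ⊢L X] (Y ⊢L X)
  (* The mirror image of IWeakPrec, which makes I in succedent position the
     least element.  Without it Bot ⊢ p is not derivable: interpreting Bot, and
     I in succedent position, by the greatest element validates all the other
     rules. *)
| IWeakSucc X Y : rule [:: X ⊢L StrI] (X ⊢L Y)
| TopL X : rule [:: StrI ⊢L X] (LF Top ⊢L X)
| TopR : rule [::] (StrI ⊢L LF Top)
| BotL : rule [::] (LF Bot ⊢L StrI)
| BotR X : rule [:: X ⊢L StrI] (X ⊢L LF Bot)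
| WhiteDiaL A P : rule [:: Circ Right (LF A) ⊢H P] (HF (WhiteDia A) ⊢H P)
| WhiteDiaR A X : rule [:: X ⊢L LF A] (Circ Right X ⊢H HF (WhiteDia A))
| BlackBoxR X x : rule [:: X ⊢L Bullet (HF x)] (X ⊢L LF (BlackBox x))
| BlackBoxL x P : rule [:: HF x ⊢H P] (LF (BlackBox x) ⊢L Bullet P)
| BlackDiaL a X : rule [:: Bullet (HF a) ⊢L X] (LF (BlackDia a) ⊢L X)
| BlackDiaR G a : rule [:: G ⊢H HF a] (Bullet G ⊢L LF (BlackDia a))
| WhiteBoxR G A : rule [:: G ⊢H Circ Left (LF A)] (G ⊢H HF (WhiteBox A))
| WhiteBoxL A X : rule [:: LF A ⊢L X] (HF (WhiteBox A) ⊢H Circ Left X).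

(* Every sequent of a derivation satisfies the position restriction. *)
Inductive derivable (V : Type) : sequent V -> Prop :=
| Derive ps c :
    rule ps c -> seq_ok c -> (forall s, List.In s ps -> derivable s) ->
    derivable c.

(* A^τ *)
Fixpoint tau_up (V : Type) (A : lat V) : lform V :=
  match A with
  | LatAtom p => BlackDia (WhiteBox (Atom p))
  | LatTop => BlackDia (WhiteBox Top)
  | LatBot => BlackDia (WhiteBox Bot)
  | LatAnd A B => BlackDia (Cap (WhiteBox (tau_up A)) (WhiteBox (tau_up B)))
  | LatOr A B => BlackDia (Cup (WhiteBox (tau_up A)) (WhiteBox (tau_up B)))
  end.

(* A_τ *)
Fixpoint tau_down (V : Type) (A : lat V) : lform V :=
  match A with
  | LatAtom p => BlackBox (WhiteDia (Atom p))
  | LatTop => BlackBox (WhiteDia Top)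
  | LatBot => BlackBox (WhiteDia Bot)
  | LatAnd A B => BlackBox (Cap (WhiteDia (tau_down A)) (WhiteDia (tau_down B)))
  | LatOr A B => BlackBox (Cup (WhiteDia (tau_down A)) (WhiteDia (tau_down B)))
  end.

(* Main.v *)
Require Import Defs.
From mathcomp Require Import all_boot.
Local Open Scope dll_scope.

(** Both translations insert an adjoint pair at every node, and the rules of
    D.LL make [BlackDia (WhiteBox A)] entail [A] and [A] entail
    [BlackBox (WhiteDia A)], but not conversely: in a model, [BlackDia] after
    [WhiteBox] may be a nontrivial interior operator.  Hence
    [tau_down B] does not entail [tau_up B] in general, and derivations of
    [tau_up A ⊢ tau_down B] and [tau_up B ⊢ tau_down C] cannot be composed by a
    cut.  Transitivity is therefore eliminated before translating.

    Lattice logic has a cut-free calculus ([lat_seq]) whose sequents have exactly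
    one formula on each side.  Identity, substitution and cut are admissible in
    it ([lat_seq_refl], [lat_seq_subst], [lat_seq_cut]), so it proves every
    Hilbert theorem ([hilbert_lat_seq]).  Each of its rules is then simulated in
    D.LL ([lat_seq_derivable]).  A left rule only sees the outermost [BlackDia]
    of the translation on the left: by residuation the right-hand formula moves
    under [Circ Left], where weakening, contraction and the rules for [Cap] and
    [Cup] give the rule.  Right rules are the mirror image, through
    [BlackBox] and [Circ Right]. *)

(** * A cut-free calculus for lattice logic *)

(** With identity restricted to atoms, a compound formula comes from a rule for
    its main connective or is the arbitrary side of a constant axiom, as the
    inversions require. *)
Inductive lat_seq {V : Type} : lat V -> lat V -> Prop :=
| SeqId p : lat_seq (LatAtom p) (LatAtom p)
| SeqBotL C : lat_seq LatBot C
| SeqTopR A : lat_seq A LatTop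
| SeqAndL1 A B C : lat_seq A C -> lat_seq (LatAnd A B) C
| SeqAndL2 A B C : lat_seq B C -> lat_seq (LatAnd A B) C
| SeqAndR A B C : lat_seq A B -> lat_seq A C -> lat_seq A (LatAnd B C)
| SeqOrL A B C : lat_seq A C -> lat_seq B C -> lat_seq (LatOr A B) C
| SeqOrR1 A B C : lat_seq A B -> lat_seq A (LatOr B C)
| SeqOrR2 A B C : lat_seq A C -> lat_seq A (LatOr B C).
#[local] Hint Constructors lat_seq : core.

Lemma lat_seq_refl (V : Type) (A : lat V) : lat_seq A A.
Proof. by elim: A => *; auto. Qed.

Lemma lat_seq_subst (V : eqType) (p : V) (C A B : lat V) :
  lat_seq A B -> lat_seq (lat_subst p C A) (lat_subst p C B).
Proof. by elim=> /= *; auto using lat_seq_refl. Qed.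

(** In the inversions below, going up the derivation, a formula on the right
    passes unchanged through left rules until it meets [SeqBotL], which admits
    any right-hand side, or the right rule that introduces it; [LatBot] has no
    such rule.  Formulas on the left are dual. *)
Lemma lat_seq_botR {V : Type} {A C : lat V} : lat_seq A LatBot -> lat_seq A C.
Proof. by move E: LatBot => B AB; elim: AB E => //=; auto. Qed.

Lemma lat_seq_topL {V : Type} {A C : lat V} : lat_seq LatTop C -> lat_seq A C.
Proof. by move E: LatTop => B BC; elim: BC E => //=; auto. Qed.

Lemma lat_seq_andR {V : Type} {A B C : lat V} :
  lat_seq A (LatAnd B C) -> lat_seq A B /\ lat_seq A C.
Proof.
move E: (LatAnd B C) => D AD.
elim: AD E => // {A D}; try by auto.
- by move=> A A' D _ IH /IH[]; auto.
- by move=> A A' D _ IH /IH[]; auto.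
- by move=> A B' C' AB _ AC _ [-> ->].
- by move=> A A' D _ IH _ IH' E; case: (IH E); case: (IH' E); auto.
Qed.

Lemma lat_seq_orL {V : Type} {A B C : lat V} :
  lat_seq (LatOr A B) C -> lat_seq A C /\ lat_seq B C.
Proof.
move E: (LatOr A B) => D DC.
elim: DC E => // {C D}; try by auto.
- by move=> D C C' _ IH _ IH' E; case: (IH E); case: (IH' E); auto.
- by move=> A' B' C AC _ BC _ [-> ->].
- by move=> D C C' _ IH /IH[]; auto.
- by move=> D C C' _ IH /IH[]; auto.
Qed.

(** Induction on the cut formula.  Inversion makes one of the two premises
    available at smaller cut formulas; an inner induction on the other one
    permutes the cut upwards until it becomes principal. *)
Lemma lat_seq_cut {V : Type} {A B C : lat V} :
  lat_seq A B -> lat_seq B C -> lat_seq A C.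
Proof.
elim: B A C => [p|||B1 IH1 B2 IH2|B1 IH1 B2 IH2] A C AB BC.
- by move E: (LatAtom p) AB => B AB; elim: AB E BC => //=;
     auto => q [->].
- exact: lat_seq_topL BC.
- exact: lat_seq_botR AB.
- have [AB1 AB2] := lat_seq_andR AB.
  move E: (LatAnd B1 B2) BC => B BC.
  elim: BC E {AB} => // {B C}; try by auto.
  + by move=> D D' C DC _ [E _]; subst D; exact: IH1 DC.
  + by move=> D D' C DC _ [_ E]; subst D'; exact: IH2 DC.
- have [B1C B2C] := lat_seq_orL BC.
  move E: (LatOr B1 B2) AB => B AB.
  elim: AB E {BC} => // {A B}; try by auto.
  + by move=> A D D' AD _ [E _]; subst D; exact: IH1 AD B1C.
  + by move=> A D D' AD _ [_ E]; subst D'; exact: IH2 AD B2C.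
Qed.

Lemma hilbert_lat_seq {V : eqType} {A B : lat V} : hilbert A B -> lat_seq A B.
Proof.
by elim=> *; auto using lat_seq_refl, lat_seq_subst; apply: lat_seq_cut; eauto.
Qed.

(** * Derived rules of D.LL *)

Lemma derive0 {V : Type} {c : sequent V} :
  rule [::] c -> seq_ok c -> derivable c.
Proof. by move=> r ok; apply: Derive r ok _. Qed.

Lemma derive1 {V : Type} {c1 c : sequent V} :
  rule [:: c1] c -> seq_ok c -> derivable c1 -> derivable c.
Proof. by move=> r ok d1; apply: Derive r ok _ => s [<-|[]]. Qed.

Lemma derive2 {V : Type} {c1 c2 c : sequent V} :
  rule [:: c1; c2] c -> seq_ok c -> derivable c1 -> derivable c2 ->
  derivable c.
Proof. by move=> r ok d1 d2; apply: Derive r ok _ => s [<-|[<-|[]]]. Qed.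

(** The side conditions [lstr_ok] are the position restriction, which every
    sequent of a derivation must satisfy. *)
Section DerivedRules.

Variable V : Type.
Implicit Types (A B : lform V) (X : lstr V).

(** Residuation turns [BlackDia] on the left into [Circ Left] on the right. *)
Lemma derivable_black_diaL (a : hform V Left) X :
  lstr_ok Succedent X ->
  derivable (HF a ⊢H Circ Left X) -> derivable (LF (BlackDia a) ⊢L X).
Proof.
move=> okX aX; apply: derive1 (BlackDiaL _ _) _ _ => //.
by apply: derive1 (RDown (DispBullet _ _)) _ aX.
Qed.

Lemma derivable_black_boxR X (x : hform V Right) :
  lstr_ok Precedent X ->
  derivable (Circ Right X ⊢H HF x) -> derivable (X ⊢L LF (BlackBox x)).
Proof.
move=> okX Xx; have ok : seq_ok (X ⊢L LF (BlackBox x)) by rewrite /= okX.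
apply: derive1 (BlackBoxR _ _) ok _.
by apply: derive1 (RDown (DispCirc _ _)) _ Xx; rewrite /= okX.
Qed.

Lemma derivable_white_boxL A X :
  lstr_ok Succedent X ->
  derivable (LF A ⊢L X) -> derivable (HF (WhiteBox A) ⊢H Circ Left X).
Proof. by move=> okX; apply: derive1 (WhiteBoxL _ _) _. Qed.

Lemma derivable_white_diaR X A :
  lstr_ok Precedent X ->
  derivable (X ⊢L LF A) -> derivable (Circ Right X ⊢H HF (WhiteDia A)).
Proof. by move=> okX; apply: derive1 (WhiteDiaR _ _) _; rewrite /= okX. Qed.

Lemma derivable_black_dia_white_boxL A X :
  lstr_ok Succedent X ->
  derivable (LF A ⊢L X) -> derivable (LF (BlackDia (WhiteBox A)) ⊢L X).
Proof.
by move=> okX AX; apply: derivable_black_diaL => //; apply: derivable_white_boxL.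
Qed.

Lemma derivable_black_box_white_diaR X A :
  lstr_ok Precedent X ->
  derivable (X ⊢L LF A) -> derivable (X ⊢L LF (BlackBox (WhiteDia A))).
Proof.
by move=> okX XA; apply: derivable_black_boxR => //; apply: derivable_white_diaR.
Qed.

Lemma derivable_capL1 d (s t : hform V d) S :
  hstr_ok Succedent S ->
  derivable (HF s ⊢H S) -> derivable (HF (Cap s t) ⊢H S).
Proof.
move=> okS sS; apply: derive1 (CapL _ _ _) _ _ => //.
by apply: derive1 (WeakPrec _ _ _) _ sS.
Qed.

Lemma derivable_capL2 d (s t : hform V d) S :
  hstr_ok Succedent S ->
  derivable (HF t ⊢H S) -> derivable (HF (Cap s t) ⊢H S).
Proof.
move=> okS tS; apply: derive1 (CapL _ _ _) _ _ => //.
apply: derive1 (ExchPrec _ _ _) _ _ => //.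
by apply: derive1 (WeakPrec _ _ _) _ tS.
Qed.

(** [CapR] concludes with [S · S], which contraction merges. *)
Lemma derivable_capR d (s t : hform V d) S :
  hstr_ok Precedent S ->
  derivable (S ⊢H HF s) -> derivable (S ⊢H HF t) ->
  derivable (S ⊢H HF (Cap s t)).
Proof.
move=> okS Ss St; apply: derive1 (ContrPrec _ _) _ _; first by rewrite /= okS.
by apply: derive2 (CapR _ _ _ _) _ Ss St; rewrite /= okS.
Qed.

Lemma derivable_cupL d (s t : hform V d) S :
  hstr_ok Succedent S ->
  derivable (HF s ⊢H S) -> derivable (HF t ⊢H S) ->
  derivable (HF (Cup s t) ⊢H S).
Proof.
move=> okS sS tS; apply: derive1 (ContrSucc _ _) _ _ => //.
by apply: derive2 (CupL _ _ _ _) _ sS tS; rewrite /= okS.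
Qed.

Lemma derivable_cupR1 d (s t : hform V d) S :
  hstr_ok Precedent S ->
  derivable (S ⊢H HF s) -> derivable (S ⊢H HF (Cup s t)).
Proof.
move=> okS Ss; apply: derive1 (CupR _ _ _) _ _; first by rewrite /= okS.
by apply: derive1 (WeakSucc _ _ _) _ Ss; rewrite /= okS.
Qed.

Lemma derivable_cupR2 d (s t : hform V d) S :
  hstr_ok Precedent S ->
  derivable (S ⊢H HF t) -> derivable (S ⊢H HF (Cup s t)).
Proof.
move=> okS St; apply: derive1 (CupR _ _ _) _ _; first by rewrite /= okS.
apply: derive1 (ExchSucc _ _ _) _ _; first by rewrite /= okS.
by apply: derive1 (WeakSucc _ _ _) _ St; rewrite /= okS.
Qed.

Lemma derivable_botL X : lstr_ok Succedent X -> derivable (LF Bot ⊢L X).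
Proof.
by move=> okX; apply: derive1 (IWeakSucc _ _) _ _ => //; apply: derive0 (BotL _) _.
Qed.

Lemma derivable_topR X : lstr_ok Precedent X -> derivable (X ⊢L LF Top).
Proof.
move=> okX; apply: derive1 (IWeakPrec _ _) _ _; first by rewrite /= okX.
exact: derive0 (TopR _) _.
Qed.

End DerivedRules.

(** * Simulation and completeness *)

Lemma lat_seq_derivable {V : Type} {A B : lat V} :
  lat_seq A B -> derivable (LF (tau_up A) ⊢L LF (tau_down B)).
Proof.
elim=> {A B} /=.
- move=> p; apply: derivable_black_dia_white_boxL => //.
  by apply: derivable_black_box_white_diaR => //; apply: derive0 (LId _) _.
- by move=> C; apply: derivable_black_dia_white_boxL => //; apply: derivable_botL.
- by move=> A; apply: derivable_black_box_white_diaR => //; apply: derivable_topR.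
- move=> A B C _ AC; apply: derivable_black_diaL => //.
  by apply: derivable_capL1 => //; apply: derivable_white_boxL.
- move=> A B C _ BC; apply: derivable_black_diaL => //.
  by apply: derivable_capL2 => //; apply: derivable_white_boxL.
- move=> A B C _ AB _ AC; apply: derivable_black_boxR => //.
  by apply: derivable_capR => //; apply: derivable_white_diaR.
- move=> A B C _ AC _ BC; apply: derivable_black_diaL => //.
  by apply: derivable_cupL => //; apply: derivable_white_boxL.
- move=> A B C _ AB; apply: derivable_black_boxR => //.
  by apply: derivable_cupR1 => //; apply: derivable_white_diaR.
- move=> A B C _ AC; apply: derivable_black_boxR => //.
  by apply: derivable_cupR2 => //; apply: derivable_white_diaR.
Qed.

Theorem mainTheorem2 (AtProp : eqType) (A B : lat AtProp) :
  hilbert A B -> derivable (LF (tau_up A) ⊢L LF (tau_down B)).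
Proof. by move/hilbert_lat_seq/lat_seq_derivable. Qed.
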